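(* Let $\mathsf{L}$ be an orthocomplemented lattice (not necessarily complete) and let $\mathsf{E}_{\mathsf{L}}$ be its event space completion. The inclusion $\mathsf{inc}:\mathsf{L}\hookrightarrow\mathsf{E}_{\mathsf{L}}$, $a\mapsto[a]$, is an injective homomorphism of orthocomplemented lattices, and it is an isomorphism if and only if $\mathsf{L}$ is complete. Also, if $\mathsf{L}$ and $\mathsf{L}'$ are isomorphic orthocomplemented lattices, then so are $\mathsf{E}_{\mathsf{L}}$ and $\mathsf{E}_{\mathsf{L}'}$.
   Context: Let $(\mathsf{L},\subseteq,\cup,\cap,{}^c,\mathbf{0},\mathbf{1})$ be an orthocomplemented lattice. A term is a function $i\in I\mapsto a^i\in\mathsf{L}$, written $\bigsqcup_{i\in I}a^i$, with $|I|\leq2^{|\mathsf{L}|}$; $\mathsf{T}(\mathsf{L})$ is the collection of terms. Put $\bigsqcup_{i\in I}a^i\backsim\bigsqcup_{j\in J}b^j$ iff for every $i\in I$ there is $j\in J$ with $a^i\subseteq b^j$ (if $J=\emptyset$: $a^i=\mathbf{0}$), and for every $j\in J$ there is $i\in I$ with $b^j\subseteq a^i$ (if $I=\emptyset$: $b^j=\mathbf{0}$). This is an equivalence relation; $\mathsf{D}(\mathsf{L}):=\mathsf{T}(\mathsf{L})/\backsim$. For families with larger index sets, $[\bigsqcup_{i\in I}a^i]$ denotes the class of the terms equivalent (same condition) to the family. Every class has a representative with $I\neq\emptyset$, and such representatives are always used. Order: $[\bigsqcup_{i\in I}a^i]\leq[\bigsqcup_{j\in J}b^j]$ iff $[\bigsqcup_{i\in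 I}a^i\sqcup\bigsqcup_{j\in J}b^j]=[\bigsqcup_{j\in J}b^j]$ (here $\sqcup$ is the family on the disjoint union of $I$ and $J$). With it $\mathsf{D}(\mathsf{L})$ is a (completely distributive) complete lattice with suprema $\bigvee$, infima $\bigwedge$, bottom $[\mathbf{0}]$ and top $[\mathbf{1}]$. One regards $\mathsf{L}\subseteq\mathsf{D}(\mathsf{L})$ via the injection $a\mapsto[a]$; then $[\bigsqcup_{i\in I}a^i]=\bigvee_{i\in I}a^i$. The (well-defined, order-reversing) function $*:\mathsf{D}(\mathsf{L})\to\mathsf{D}(\mathsf{L})$ is $\big(\bigvee_{i\in I}a^i\big)^*=\bigwedge_{i\in I}(a^i)^c$, with infimum taken in $\mathsf{D}(\mathsf{L})$. The event space completion of $\mathsf{L}$ is $\mathsf{E}_{\mathsf{L}}=\{\mathbb{A}\in\mathsf{D}(\mathsf{L}):\mathbb{A}=\mathbb{A}^{**}\}=\{\mathbb{A}^*:\mathbb{A}\in\mathsf{D}(\mathsf{L})\}$ with the inherited order. It contains $\mathsf{L}$ and is an orthocomplemented complete lattice with the same infima, bottom and top as $\mathsf{D}(\mathsf{L})$, supremum $\coprod S=(\bigvee S)^{**}$ for $S\subseteq\mathsf{E}_{\mathsf{L}}$, and orthocomplementation $*$. *)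

(* Defs.v *)
From HB Require Import structures.
From mathcomp Require Import all_boot all_order generic_quotient.
From mathcomp Require Import boolp classical_sets functions cardinality.

Set Implicit Arguments.
Unset Strict Implicit.
Unset Printing Implicit Defensive.

Import Order.TTheory.

Local Open Scope classical_set_scope.
Local Open Scope order_scope.
Local Open Scope quotient_scope.

HB.mixin Record hasOrthocomplement (d : Order.disp_t) (T : Type)
    of Order.TBLattice d T := {
  ocompl : T -> T;
  ocomplK : involutive ocompl;
  ocompl_anti : forall x y : T, x <= y -> ocompl y <= ocompl x;
  meetxoC : forall x : T, x `&` ocompl x = \bot;
  joinxoC : forall x : T, x `|` ocompl x = \top;
}.

#[short(type="orthoLatticeType")]
HB.structure Definition OrthoLattice (d : Order.disp_t) :=
  { T of hasOrthocomplement d T & Order.TBLattice d T }.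

Definition ortho_morphism (d d' : Order.disp_t) (L : orthoLatticeType d)
    (L' : orthoLatticeType d') (f : L -> L') : Prop :=
  [/\ Order.meet_morphism f, Order.join_morphism f,
      f \bot = \bot, f \top = \top & {morph f : a / ocompl a}].

Definition ortho_isomorphism (d d' : Order.disp_t) (L : orthoLatticeType d)
    (L' : orthoLatticeType d') (f : L -> L') : Prop :=
  ortho_morphism f /\ bijective f.

Definition ortho_isomorphic (d d' : Order.disp_t) (L : orthoLatticeType d)
    (L' : orthoLatticeType d') : Prop :=
  exists f : L -> L', ortho_isomorphism f.

Definition complete_lattice (d : Order.disp_t) (T : porderType d) : Prop :=
  forall S : set T, (supremums S !=set0) /\ (infimums S !=set0).

Section Families.
Context {d : Order.disp_t} {L : orthoLatticeType d}.

(* When [J] is empty, the elements of the family [a] must all be [\bot]. *)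
Definition fam_le (I J : Type) (a : I -> L) (b : J -> L) : Prop :=
  forall i : I, (exists j : J, a i <= b j) \/ (~ inhabited J /\ a i = \bot).

Definition fam_eq (I J : Type) (a : I -> L) (b : J -> L) : Prop :=
  fam_le a b /\ fam_le b a.

Definition fam_union (I J : Type) (a : I -> L) (b : J -> L) (k : I + J) : L :=
  match k with inl i => a i | inr j => b j end.

Lemma fam_leP (I J : Type) (a : I -> L) (b : J -> L) :
  fam_le a b <-> forall i, a i = \bot \/ exists j, a i <= b j.
Proof.
split=> h i; first by case: (h i) => [|[_]]; [right|left].
case: (h i) => [ai0|]; last by left.
case: (pselect (inhabited J)) => [[j]|nJ]; last by right.
by left; exists j; rewrite ai0 le0x.
Qed.

Lemma fam_le_refl (I : Type) (a : I -> L) : fam_le a a.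
Proof. by move=> i; left; exists i. Qed.

Lemma fam_le_trans (I J K : Type) (a : I -> L) (b : J -> L) (c : K -> L) :
  fam_le a b -> fam_le b c -> fam_le a c.
Proof.
move=> /fam_leP ab /fam_leP bc; apply/fam_leP => i.
case: (ab i) => [->|[j aibj]]; first by left.
case: (bc j) => [bj0|[k bjck]]; last by right; exists k; exact: le_trans bjck.
by left; apply/eqP; rewrite -lex0 -bj0.
Qed.

Lemma fam_eq_refl (I : Type) (a : I -> L) : fam_eq a a.
Proof. by split; exact: fam_le_refl. Qed.

Lemma fam_eq_sym (I J : Type) (a : I -> L) (b : J -> L) :
  fam_eq a b -> fam_eq b a.
Proof. by case. Qed.

Lemma fam_eq_trans (I J K : Type) (a : I -> L) (b : J -> L) (c : K -> L) :
  fam_eq a b -> fam_eq b c -> fam_eq a c.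
Proof.
by move=> [ab ba] [bc cb]; split; [exact: fam_le_trans bc|exact: fam_le_trans ba].
Qed.

End Families.

(* The index sets of terms are normalized to be subsets of the power set of   *)
(* [L], so that the terms form a type in the universe of [L].                 *)
(* [term_of_card_le] shows that, up to reindexing along a bijection, this     *)
(* covers every family whose index set has cardinality at most [2^|L|].       *)
Record term (d : Order.disp_t) (L : orthoLatticeType d) := Term {
  term_idx : set (set L);
  term_fam :> term_idx -> L }.

Section Terms.
Context {d : Order.disp_t} {L : orthoLatticeType d}.

HB.instance Definition _ := gen_eqMixin (term L).
HB.instance Definition _ := gen_choiceMixin (term L).

Lemma term_of_card_le (I : Type) (a : I -> L) :
  ([set: I] #<= [set: set L])%card ->
  exists (t : term L) (e : I -> term_idx t),
    bijective e /\ forall i, t (e i) = a i.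
Proof.
move=> /card_leP[f0].
have If i : [set: I] i by [].
pose f i := val (f0 (SigSub (mem_set (If i)))).
have finj : injective f.
  by move=> i j /val_inj/inj; rewrite !in_setE => /(_ Logic.I Logic.I) [].
have fr i : f i \in range f by rewrite in_setE; exists i.
have ginv (x : range f) : exists i, f i = val x.
  by case: x => x /=; rewrite in_setE => -[i _ <-]; exists i.
pose g x := projT1 (cid (ginv x)).
have gE x : f (g x) = val x by rewrite /g; case: cid.
pose e i : range f := SigSub (fr i).
have eK : cancel e g by move=> i; apply: finj; rewrite gE.
exists (Term (fun x : range f => a (g x))), e; split; last first.
  by move=> i /=; rewrite eK.
by exists g => // x; apply: val_inj; rewrite /= gE.
Qed.

Lemma fam_eq_term (I : Type) (a : I -> L) : exists t : term L, fam_eq t a.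
Proof.
pose X := [set S : set L | exists i, S = [set a i]].
have XP (x : X) : exists i, val x = [set a i].
  by case: x => x /=; rewrite in_setE.
have iX i : [set a i] \in X by rewrite in_setE; exists i.
exists (Term (fun x : X => a (projT1 (cid (XP x))))); split=> [x|i] /=; left.
  by eexists.
exists (SigSub (iX i)); case: cid => j /= /seteqP[/(_ (a i) erefl) /= -> _].
by [].
Qed.

Definition term_eq : rel (term L) := fun s t => `[< fam_eq s t >].

Lemma term_eq_refl : reflexive term_eq.
Proof. by move=> s; apply/asboolP/fam_eq_refl. Qed.

Lemma term_eq_sym : symmetric term_eq.
Proof. by move=> s t; apply/idP/idP => /asboolP/fam_eq_sym/asboolP. Qed.

Lemma term_eq_trans : transitive term_eq.
Proof.
by move=> t s u /asboolP st /asboolP tu; apply/asboolP/(fam_eq_trans st tu).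
Qed.

Canonical term_equiv := EquivRel term_eq term_eq_refl term_eq_sym term_eq_trans.

End Terms.

Definition completion (d : Order.disp_t) (L : orthoLatticeType d) :=
  {eq_quot @term_equiv d L}.

HB.instance Definition _ (d : Order.disp_t) (L : orthoLatticeType d) :=
  Choice.on (completion L).

Section Completion.
Context {d : Order.disp_t} {L : orthoLatticeType d}.
Local Notation D := (completion L).

(* The index type [I] is arbitrary: [class a] is the equivalence class formed *)
(* by the terms equivalent to the family [a].                                 *)
Definition class (I : Type) (a : I -> L) : D :=
  \pi_({eq_quot @term_equiv d L}) (projT1 (cid (fam_eq_term a))).

Definition class1 (a : L) : D := class (fun _ : unit => a).

Lemma classP (I J : Type) (a : I -> L) (b : J -> L) :
  class a = class b <-> fam_eq a b.
Proof.
rewrite /class; case: cid => s sa; case: cid => t tb /=; split.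
  move=> /eqmodP/asboolP st.
  exact: fam_eq_trans (fam_eq_trans (fam_eq_sym sa) st) tb.
move=> ab; apply/eqmodP/asboolP.
exact: fam_eq_trans (fam_eq_trans sa ab) (fam_eq_sym tb).
Qed.

Lemma class_term (t : term L) : class t = \pi_({eq_quot @term_equiv d L}) t.
Proof. by rewrite /class; case: cid => s /= st; apply/eqmodP/asboolP. Qed.

Definition rep (x : D) : term L := repr (x : {eq_quot @term_equiv d L}).

Lemma repK (x : D) : class (rep x) = x.
Proof. by rewrite class_term /rep reprK. Qed.

Lemma class_rep (I : Type) (a : I -> L) : fam_eq (rep (class a)) a.
Proof. by apply/classP; rewrite repK. Qed.

Lemma class_nonempty_rep (x : D) :
  exists2 t : term L, inhabited (term_idx t) & class t = x.
Proof.
pose b (o : option (term_idx (rep x))) : L := if o is Some i then rep x i else \bot.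
have rb : fam_eq (rep x) b.
  split; apply/fam_leP; first by move=> i; right; exists (Some i).
  by move=> [i|]; [right; exists i|left].
have [I [e eI]] : exists (t : term L) (z : term_idx t), fam_eq t b.
  have [t [tb bt]] := fam_eq_term b.
  case: (pselect (inhabited (term_idx t))) => [[z]|nt]; first by exists t, z.
  pose X : set (set L) := setT.
  have sX : set0 \in X by rewrite in_setE.
  exists (Term (fun _ : X => \bot)), (SigSub sX).
  split; apply/fam_leP => i; first by left.
  by case: (bt i) => [[j]|[_ ->]]; [case: nt|left].
by exists I => //; rewrite -[RHS]repK; apply/classP/(fam_eq_trans eI)/fam_eq_sym.
Qed.

Definition completion_le : rel D :=
  fun x y => class (fam_union (rep x) (rep y)) == class (rep y).

Lemma fam_union_eq (I J : Type) (a : I -> L) (b : J -> L) :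
  fam_eq (fam_union a b) b <-> fam_le a b.
Proof.
split=> [[/fam_leP abb _]|/fam_leP ab].
  by apply/fam_leP => i; exact: (abb (inl i)).
split; apply/fam_leP; last by move=> j; right; exists (inr j).
by move=> [i|j] /=; [exact: ab|right; exists j].
Qed.

Lemma completion_leE (x y : D) : completion_le x y <-> fam_le (rep x) (rep y).
Proof.
split=> [/eqP/classP/fam_union_eq//|xy].
by apply/eqP/classP/fam_union_eq.
Qed.

Lemma completion_le_refl : reflexive completion_le.
Proof. by move=> x; apply/completion_leE/fam_le_refl. Qed.

Lemma completion_le_anti : antisymmetric completion_le.
Proof.
move=> x y /andP[/completion_leE xy /completion_leE yx].
by rewrite -[x]repK -[y]repK; apply/classP.
Qed.

Lemma completion_le_trans : transitive completion_le.
Proof.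
move=> y x z /completion_leE xy /completion_leE yz.
exact/completion_leE/(fam_le_trans xy).
Qed.

HB.instance Definition _ := Order.Le_isPOrder.Build d D
  completion_le_refl completion_le_anti completion_le_trans.

Lemma class_leP (I J : Type) (a : I -> L) (b : J -> L) :
  class a <= class b <-> fam_le a b.
Proof.
have [ra ar] := class_rep a; have [rb br] := class_rep b.
split=> [/completion_leE h|h].
  exact: fam_le_trans (fam_le_trans ar h) rb.
by apply/completion_leE; exact: fam_le_trans (fam_le_trans ra h) br.
Qed.

Lemma class_le_union (I J : Type) (a : I -> L) (b : J -> L) :
  class a <= class b <-> class (fam_union a b) = class b.
Proof. by rewrite class_leP classP fam_union_eq. Qed.

Lemma class1_le (a b : L) : (class1 a <= class1 b) = (a <= b).
Proof.
apply/idP/idP => [/class_leP/fam_leP/(_ tt)[->|[]//]|ab]; first exact: le0x.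
by apply/class_leP => _; left; exists tt.
Qed.

Lemma class1_inj : injective class1.
Proof. by move=> a b ab; apply: le_anti; rewrite -!class1_le ab lexx. Qed.

Lemma class_leif (I : Type) (a : I -> L) (x : D) :
  class a <= x <-> forall i, class1 (a i) <= x.
Proof.
rewrite -(repK x); split=> [/class_leP h i|h].
  by apply/class_leP => _; exact: h.
by apply/class_leP => i; have /class_leP/(_ tt) := h i.
Qed.

Lemma le_completionP (x y : D) :
  x <= y <-> forall a : L, class1 a <= x -> class1 a <= y.
Proof.
split=> [xy a ax|h]; first exact: le_trans xy.
rewrite -(repK x); apply/class_leif => i; apply: h.
by rewrite -{2}(repK x); apply/class_leP => _; left; exists i.
Qed.

Lemma completion_le0x (x : D) : class1 \bot <= x.
Proof. by rewrite -(repK x); apply/class_leP/fam_leP => _; left. Qed.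

Lemma completion_lex1 (x : D) : x <= class1 \top.
Proof.
rewrite -(repK x); apply/class_leP => i; left; exists tt; exact: lex1.
Qed.

HB.instance Definition _ := Order.hasBottom.Build d D completion_le0x.
HB.instance Definition _ := Order.hasTop.Build d D completion_lex1.

Lemma completion_complete : complete_lattice D.
Proof.
move=> S; split.
  exists (class (fun a : {a : L | exists2 x, S x & class1 a <= x} => sval a)).
  split=> [x Sx|y yub].
    apply/le_completionP => a ax.
    have aS : exists2 x, S x & class1 a <= x by exists x.
    by apply/class_leP => _; left; exists (exist _ a aS).
  by apply/class_leif => -[a [x Sx ax]] /=; exact: le_trans (yub _ Sx).
exists (class (fun a : {a : L | forall x, S x -> class1 a <= x} => sval a)).
split=> [x Sx|y ylb].
  by apply/class_leif => -[a aS]; exact: aS.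
apply/le_completionP => a ay.
have aS x : S x -> class1 a <= x by move=> Sx; exact: le_trans (ylb _ Sx).
by apply/class_leP => _; left; exists (exist _ a aS).
Qed.

(* [\top] is the infimum of the empty set. *)
Definition Dinf (S : set D) : D := infimum \top S.

Definition Dsup (S : set D) : D := supremum \bot S.

Lemma DinfP (S : set D) : infimums S (Dinf S).
Proof.
rewrite /Dinf /infimum; case: ifPn => [/eqP ->|_].
  by split=> // y _; exact: lex1.
have [_ [z]] := completion_complete S; exact: xgetI.
Qed.

Lemma DsupP (S : set D) : supremums S (Dsup S).
Proof.
rewrite /Dsup /supremum; case: ifPn => [/eqP ->|_].
  by split=> // y _; exact: le0x.
have [[z +] _] := completion_complete S; exact: xgetI.
Qed.

Lemma le_Dinf (S : set D) (x : D) : x <= Dinf S <-> lbound S x.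
Proof.
have [lb glb] := DinfP S.
by split=> [xS y Sy|]; [exact: le_trans (lb _ Sy)|exact: glb].
Qed.

Lemma Dsup_le (S : set D) (x : D) : Dsup S <= x <-> ubound S x.
Proof.
have [ub lub] := DsupP S.
by split=> [Sx y Sy|]; [exact: le_trans (ub _ Sy) _|exact: lub].
Qed.

Lemma class_Dsup (I : Type) (a : I -> L) :
  class a = Dsup (range (fun i => class1 (a i))).
Proof.
apply: le_anti; apply/andP; split.
  by apply/class_leif => i; have [ub _] := DsupP (range (fun i => class1 (a i)));
    apply: ub; exists i.
apply/Dsup_le => _ [i _ <-].
by apply/class_leP => _; left; exists i.
Qed.

(* [star_class] shows that any family representing [x] can be used; this      *)
(* includes the empty family, since [Dinf set0 = \top = star \bot].           *)
Definition star (x : D) : D :=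
  Dinf (range (fun i : term_idx (rep x) => class1 (ocompl (rep x i)))).

Lemma le_starP (x : D) (I : Type) (a : I -> L) :
  x <= star (class a) <-> forall i, x <= class1 (ocompl (a i)).
Proof.
have [ra ar] := class_rep a.
have key (J K : Type) (b : J -> L) (c : K -> L) : fam_le b c ->
    (forall k, x <= class1 (ocompl (c k))) ->
    forall j, x <= class1 (ocompl (b j)).
  move=> /fam_leP bc h j; case: (bc j) => [->|[k bjck]].
    apply: le_trans (lex1 x) _; rewrite class1_le.
    by rewrite -[X in X <= _]ocomplK ocompl_anti // le0x.
  by apply: le_trans (h k) _; rewrite class1_le ocompl_anti.
rewrite /star le_Dinf; split=> [h|h].
  by apply: key ar _ => k; apply: h; exists k.
by move=> _ [i _ <-]; exact: (key _ _ _ _ ra h).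
Qed.

Lemma star_class (I : Type) (a : I -> L) :
  star (class a) = Dinf (range (fun i => class1 (ocompl (a i)))).
Proof.
apply: le_anti; apply/andP; split.
  by apply/le_Dinf => _ [i _ <-]; move: i; exact/le_starP.
apply/le_starP => i; have [lb _] := DinfP (range (fun i => class1 (ocompl (a i)))).
by apply: lb; exists i.
Qed.

Lemma star_galois (x y : D) : (x <= star y) = (y <= star x).
Proof.
suff h (u v : D) : u <= star v -> v <= star u by apply/idP/idP; exact: h.
rewrite -(repK u) -(repK v) => /le_starP h.
apply/le_starP => i; apply/class_leif => j.
have /class_leif/(_ i) := h j; rewrite !class1_le => /ocompl_anti.
by rewrite ocomplK.
Qed.

Lemma le_starstar (x : D) : x <= star (star x).
Proof. by rewrite star_galois. Qed.

Lemma star_anti (x y : D) : x <= y -> star y <= star x.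
Proof. by move=> xy; rewrite star_galois; exact: le_trans (le_starstar y). Qed.

Lemma starK3 (x : D) : star (star (star x)) = star x.
Proof. by apply: le_anti; rewrite le_starstar star_anti // le_starstar. Qed.

Lemma star_class1 (a : L) : star (class1 a) = class1 (ocompl a).
Proof.
apply: le_anti; apply/andP; split; last by apply/le_starP.
by have /le_starP/(_ tt) := lexx (star (class1 a)).
Qed.

Lemma star0 : star \bot = \top.
Proof. by apply: le_anti; rewrite lex1 star_galois le0x. Qed.

Lemma star_meet (x y : D) : y <= x -> y <= star x -> y = \bot.
Proof.
move=> yx yxs; apply: le_anti; rewrite le0x andbT; apply/le_completionP => a ay.
have ax := le_trans ay yx; have axs := le_trans ay yxs.
suff -> : a = \bot by exact: lexx.
rewrite -(repK x) in ax axs; move/le_starP: axs => axs.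
have /class_leP/fam_leP/(_ tt)[//|[i axi]] := ax.
apply: le_anti; rewrite le0x andbT -(meetxoC (rep x i)) lexI axi /=.
by rewrite -class1_le.
Qed.

End Completion.

Record event_completion (d : Order.disp_t) (L : orthoLatticeType d) :=
  EventCompletion {
    event_val :> completion L;
    event_valP : event_val == star (star event_val) }.
Arguments event_val {d L} _.

HB.instance Definition _ (d : Order.disp_t) (L : orthoLatticeType d) :=
  [isSub for @event_val d L].
HB.instance Definition _ (d : Order.disp_t) (L : orthoLatticeType d) :=
  [Choice of event_completion L by <:].
HB.instance Definition _ (d : Order.disp_t) (L : orthoLatticeType d) :=
  [SubChoice_isSubPOrder of event_completion L by <: with d].

Section EventCompletion.
Context {d : Order.disp_t} {L : orthoLatticeType d}.
Local Notation D := (completion L).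
Local Notation E := (event_completion L).

Lemma event_le (x y : E) : (x <= y) = ((x : D) <= (y : D)).
Proof. by []. Qed.

Lemma event_starK (x : E) : star (star (x : D)) = x.
Proof. by rewrite -(eqP (event_valP x)). Qed.

Lemma Dinf_closed (S : set E) :
  Dinf (event_val @` S) == star (star (Dinf (event_val @` S))).
Proof.
rewrite eq_le le_starstar /=; apply/le_Dinf => _ [y Sy <-].
rewrite -event_starK; do 2! apply: star_anti.
by have [lb _] := DinfP (event_val @` S); apply: lb; exists y.
Qed.

Lemma star_closed (x : D) : star x == star (star (star x)).
Proof. by rewrite starK3. Qed.

Definition Einf (S : set E) : E := EventCompletion (Dinf_closed S).

Definition Esup (S : set E) : E :=
  EventCompletion (star_closed (star (Dsup (event_val @` S)))).

Definition Estar (x : E) : E := EventCompletion (star_closed x).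

Lemma EinfP (S : set E) : infimums S (Einf S).
Proof.
have [lb glb] := DinfP (event_val @` S); split=> [x Sx|y ylb].
  by rewrite event_le; apply: lb; exists x.
by rewrite event_le; apply: glb => _ [x Sx <-]; exact: ylb.
Qed.

Lemma EsupP (S : set E) : supremums S (Esup S).
Proof.
have [ub lub] := DsupP (event_val @` S); split=> [x Sx|y yub].
  by rewrite event_le; apply: le_trans (le_starstar _); apply: ub; exists x.
rewrite event_le -(event_starK y) /=; do 2! apply: star_anti.
by apply: lub => _ [x Sx <-]; exact: yub.
Qed.

Lemma event_complete : complete_lattice E.
Proof.
by move=> S; split; [exists (Esup S); exact: EsupP|exists (Einf S); exact: EinfP].
Qed.

Lemma Einf2P (x y z : E) : (x <= Einf [set y; z]) = (x <= y) && (x <= z).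
Proof.
have [lb glb] := EinfP [set y; z].
apply/idP/andP => [h|[xy xz]]; last by apply: glb => _ [->|->].
by split; apply: le_trans h _; apply: lb; [left|right].
Qed.

Lemma Esup2P (x y z : E) : (Esup [set x; y] <= z) = (x <= z) && (y <= z).
Proof.
have [ub lub] := EsupP [set x; y].
apply/idP/andP => [h|[xz yz]]; last by apply: lub => _ [->|->].
by split; apply: le_trans h; apply: ub; [left|right].
Qed.

HB.instance Definition _ := Order.POrder_MeetJoin_isLattice.Build d E
  Einf2P Esup2P.

Lemma class1_closed (a : L) : class1 a == star (star (class1 a)).
Proof. by rewrite !star_class1 ocomplK. Qed.

Definition inc (a : L) : E := EventCompletion (class1_closed a).

Lemma event_le0x (x : E) : inc \bot <= x.
Proof. exact: (le0x (x : D)). Qed.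

Lemma event_lex1 (x : E) : x <= inc \top.
Proof. exact: (lex1 (x : D)). Qed.

HB.instance Definition _ := Order.hasBottom.Build d E event_le0x.
HB.instance Definition _ := Order.hasTop.Build d E event_lex1.

Lemma EstarK : involutive Estar.
Proof. by move=> x; apply: val_inj; exact: event_starK. Qed.

Lemma Estar_anti (x y : E) : x <= y -> Estar y <= Estar x.
Proof. exact: star_anti. Qed.

Lemma meetx_Estar (x : E) : x `&` Estar x = \bot.
Proof.
apply: val_inj; apply: (@star_meet _ _ (x : D)).
  exact: (leIl x (Estar x)).
exact: (leIr (Estar x) x).
Qed.

Lemma joinx_Estar (x : E) : x `|` Estar x = \top.
Proof.
rewrite -[LHS]EstarK -[RHS]EstarK; congr Estar.
have -> : Estar (\top : E) = \bot.
  by rewrite -(meetx_Estar \top) meet1x.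
apply: le_anti; rewrite le0x andbT -(meetx_Estar x) lexI; apply/andP; split.
  by rewrite -[X in _ <= X]EstarK; apply: Estar_anti; exact: leUr.
by apply: Estar_anti; exact: leUl.
Qed.

HB.instance Definition _ := hasOrthocomplement.Build d E
  EstarK Estar_anti meetx_Estar joinx_Estar.

End EventCompletion.

(* Main.v *)
Require Import Defs.
From mathcomp Require Import all_boot all_order.
From mathcomp Require Import boolp classical_sets.

(** An element of the event space completion is determined by the elements of
    [L] below it ([event_le_inc]).  Hence [inc] preserves binary meets; it
    commutes with the orthocomplements by [star_class1], and by De Morgan these
    two facts already make a map of ortholattices a homomorphism
    ([ortho_morphism_meet]).

    Being regular, an element of the event completion has the form
    [star (class c)], so the elements of [L] below it are exactly the lower
    bounds of the complements of the [c i] ([inc_le_event]).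
    If [L] is complete, these are the elements below the infimum of the
    complements, which [inc] therefore maps to [star (class c)]: [inc] is onto.
    Conversely the event completion is always complete, and completeness is
    transported along an order isomorphism.

    For functoriality, a monotone map [f] preserving the bottom acts on families
    by composition, hence on classes ([push f]), and this action is functorial.
    When [f] is an isomorphism, [push f] and [push] of its inverse are adjoint,
    which yields compatibility with [star] ([push_star]) and lets [push f]
    restrict to the regular elements. *)

Set Implicit Arguments.
Unset Strict Implicit.
Unset Printing Implicit Defensive.

Import Order.TTheory.

Local Open Scope classical_set_scope.
Local Open Scope order_scope.

Lemma ocomplU (d : Order.disp_t) (L : orthoLatticeType d) (a b : L) :
  ocompl (a `|` b) = ocompl a `&` ocompl b.
Proof.
apply: le_anti; rewrite lexI !ocompl_anti ?leUl ?leUr //=.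
rewrite -[X in X <= _]ocomplK ocompl_anti // leUx.
by rewrite -{1}[a]ocomplK -{2}[b]ocomplK !ocompl_anti ?leIl ?leIr.
Qed.

Section MorphismCriteria.
Context {d d' : Order.disp_t} {L : orthoLatticeType d}.
Context {L' : orthoLatticeType d'}.
Implicit Types (f : L -> L') (g : L' -> L).

(** Joins are complements of meets of complements, and the bounds are the meet
    and the join of any element with its complement. *)
Lemma ortho_morphism_meet f :
  Order.meet_morphism f -> {morph f : a / ocompl a} -> ortho_morphism f.
Proof.
move=> fI fC.
have fU : Order.join_morphism f.
  by move=> a b; rewrite -[LHS]ocomplK -fC ocomplU fI !fC -ocomplU ocomplK.
split=> //; first by rewrite -(meetxoC \bot) fI fC meetxoC.
by rewrite -(joinxoC \bot) fU fC joinxoC.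
Qed.

Lemma ortho_morphism_mono f :
  ortho_morphism f -> injective f -> {mono f : a b / a <= b}.
Proof. by case=> fI _ _ _ _ finj a b; rewrite !leEmeet -fI (inj_eq finj). Qed.

Lemma ortho_isomorphism_mono f g :
  {homo f : a b / a <= b} -> {homo g : a b / a <= b} ->
  cancel f g -> cancel g f -> {morph f : a / ocompl a} -> ortho_isomorphism f.
Proof.
move=> fle gle fK gK fC; split; last by exists g.
apply: ortho_morphism_meet => // a b; apply: le_anti.
rewrite lexI !fle ?leIl ?leIr //= -[X in X <= _]gK; apply: fle.
by rewrite lexI -{2}[a]fK -{3}[b]fK !gle ?leIl ?leIr.
Qed.

End MorphismCriteria.

Lemma complete_lattice_mono (d d' : Order.disp_t) (T : porderType d)
    (T' : porderType d') (f : T -> T') (g : T' -> T) :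
  {mono f : x y / x <= y} -> cancel g f ->
  complete_lattice T' -> complete_lattice T.
Proof.
move=> fle gK cT' S; have [[s [us ls]] [i [li ui]]] := cT' (f @` S); split.
  exists (g s); split=> [x Sx|y yub]; first by rewrite -fle gK; apply: us; exists x.
  by rewrite -fle gK; apply: ls => _ [x Sx <-]; rewrite fle; exact: yub.
exists (g i); split=> [x Sx|y ylb]; first by rewrite -fle gK; apply: li; exists x.
by rewrite -fle gK; apply: ui => _ [x Sx <-]; rewrite fle; exact: ylb.
Qed.

Section Inclusion.
Context {d : Order.disp_t} {L : orthoLatticeType d}.
Implicit Types (a b : L) (x y : event_completion L).

Lemma inc_le a b : (inc a <= inc b) = (a <= b).
Proof. exact: class1_le. Qed.

Lemma inc_inj : injective (@inc d L).
Proof. by move=> a b [/class1_inj]. Qed.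

Lemma event_le_inc x y : (forall a, inc a <= x -> inc a <= y) -> x <= y.
Proof. by move=> xy; apply/le_completionP => a; exact: xy. Qed.

(** By regularity [x] is the [star] of the class of [rep (star x)]. *)
Lemma inc_le_event a x :
  inc a <= x <-> forall i, a <= ocompl (rep (star (x : completion L)) i).
Proof.
rewrite event_le -{1}(event_starK x) -{1}(repK (star x)).
by split=> [/le_starP h i|h]; [|apply/le_starP => i]; rewrite ?class1_le // -class1_le.
Qed.

Lemma inc_morphism : ortho_morphism (@inc d L).
Proof.
apply: ortho_morphism_meet => [a b|a].
  apply: le_anti; rewrite lexI !inc_le leIl leIr /=.
  by apply: event_le_inc => c; rewrite lexI !inc_le lexI.
by apply: val_inj; rewrite /= star_class1.
Qed.

Lemma inc_surj x : complete_lattice L -> exists a, inc a = x.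
Proof.
pose c := rep (star (x : completion L)).
move=> /(_ (range (fun i => ocompl (c i))))[_ [m [mlb mglb]]].
exists m; apply: le_anti; apply/andP; split.
  by apply/inc_le_event => i; apply: mlb; exists i.
apply: event_le_inc => a /inc_le_event ac; rewrite inc_le.
by apply: mglb => _ [i _ <-]; exact: ac.
Qed.

Lemma inc_isomorphism : ortho_isomorphism (@inc d L) <-> complete_lattice L.
Proof.
split=> [[_ [g _ gK]]|cL].
  exact: complete_lattice_mono inc_le gK event_complete.
split; first exact: inc_morphism.
pose g x := projT1 (cid (inc_surj x cL)).
have gK : cancel g inc by move=> x; rewrite /g; case: cid.
by exists g => // a; apply: inc_inj; rewrite gK.
Qed.

End Inclusion.

Definition push (d d' : Order.disp_t) (L : orthoLatticeType d)
    (L' : orthoLatticeType d') (f : L -> L') (x : completion L) :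
    completion L' :=
  class (fun i => f (rep x i)).

Section Push.
Context {d d' : Order.disp_t} {L : orthoLatticeType d}.
Context {L' : orthoLatticeType d'}.
Variables (f : L -> L').
Hypotheses (fle : {homo f : a b / a <= b}) (f0 : f \bot = \bot).

(** The bottom must be preserved because, in the comparison of families,
    entries equal to the bottom need not be dominated. *)
Lemma fam_le_comp (I J : Type) (a : I -> L) (b : J -> L) :
  fam_le a b -> fam_le (fun i => f (a i)) (fun j => f (b j)).
Proof.
move=> /fam_leP ab; apply/fam_leP => i.
by case: (ab i) => [->|[j /fle]]; [left|right; exists j].
Qed.

Lemma push_class (I : Type) (a : I -> L) :
  push f (class a) = class (fun i => f (a i)).
Proof. by apply/classP; have [ra ar] := class_rep a; split; exact: fam_le_comp. Qed.

Lemma push_homo : {homo push f : x y / x <= y}.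
Proof. by move=> x y /completion_leE xy; apply/class_leP/fam_le_comp. Qed.

Lemma pushK (g : L' -> L) : cancel g f -> cancel (push g) (push f).
Proof.
move=> gK x; rewrite -{2}(repK x) push_class; congr class.
by apply/funext => i; rewrite gK.
Qed.

End Push.

Section PushIsomorphism.
Context {d d' : Order.disp_t} {L : orthoLatticeType d}.
Context {L' : orthoLatticeType d'}.
Variables (f : L -> L') (g : L' -> L).
Hypotheses (fle : {homo f : a b / a <= b}) (gle : {homo g : a b / a <= b}).
Hypotheses (f0 : f \bot = \bot) (g0 : g \bot = \bot).
Hypotheses (fK : cancel f g) (gK : cancel g f).
Hypothesis fC : {morph f : a / ocompl a}.

Lemma push_adjoint (y : completion L') (x : completion L) :
  (push g y <= x) = (y <= push f x).
Proof.
apply/idP/idP => [/(push_homo fle f0)|/(push_homo gle g0)].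
  by rewrite (pushK fle f0 gK).
by rewrite (pushK gle g0 fK).
Qed.

(** Both sides have the same elements below them: by adjunction, [y] is below
    either one iff [push g y] is below the complement of each entry of [x]. *)
Lemma push_star (x : completion L) : push f (star x) = star (push f x).
Proof.
have below y : (y <= push f (star x)) = (y <= star (push f x)).
  have pushC i : push f (class1 (ocompl (rep x i)))
      = class1 (ocompl (f (rep x i))).
    by rewrite -fC; exact: push_class.
  rewrite -push_adjoint -{1}(repK x); apply/idP/idP => /le_starP h.
    by apply/le_starP => i; rewrite -pushC -push_adjoint.
  by apply/le_starP => i; rewrite push_adjoint pushC.
by apply: le_anti; rewrite -below lexx below lexx.
Qed.

Lemma push_closed (x : event_completion L) :
  push f x == star (star (push f x)).
Proof. by rewrite -!push_star event_starK. Qed.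

End PushIsomorphism.

Lemma event_completion_isomorphic (d d' : Order.disp_t)
    (L : orthoLatticeType d) (L' : orthoLatticeType d') :
  ortho_isomorphic L L' ->
  ortho_isomorphic (event_completion L) (event_completion L').
Proof.
move=> [f [fM [g fK gK]]]; have [_ _ f0 _ fC] := fM.
have fmono := ortho_morphism_mono fM (can_inj fK).
have fle : {homo f : a b / a <= b} by move=> a b; rewrite fmono.
have gle : {homo g : a b / a <= b} by move=> a b; rewrite -fmono !gK.
have g0 : g \bot = \bot by rewrite -f0 fK.
have gC : {morph g : a / ocompl a}.
  by move=> a; apply: (can_inj fK); rewrite fC !gK.
pose F x := EventCompletion (push_closed fle gle f0 g0 fK gK fC x).
pose G x := EventCompletion (push_closed gle fle g0 f0 gK fK gC x).
exists F; apply: (@ortho_isomorphism_mono _ _ _ _ F G).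
- by move=> x y; exact: push_homo.
- by move=> x y; exact: push_homo.
- by move=> x; apply: val_inj; exact: (pushK gle g0 fK).
- by move=> x; apply: val_inj; exact: (pushK fle f0 gK).
- by move=> x; apply: val_inj; exact: (push_star fle gle f0 g0 fK gK fC).
Qed.

Theorem theorem28 (d : Order.disp_t) (L : orthoLatticeType d) :
  [/\ ortho_morphism (@inc d L),
      injective (@inc d L),
      ortho_isomorphism (@inc d L) <-> complete_lattice L &
      forall (d' : Order.disp_t) (L' : orthoLatticeType d'),
        ortho_isomorphic L L' ->
        ortho_isomorphic (event_completion L) (event_completion L')].
Proof.
split.
- exact: inc_morphism.
- exact: inc_inj.
- exact: inc_isomorphism.
- by move=> d' L'; exact: event_completion_isomorphic.
Qed.
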